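(* Let $k\ge 1$ and let $q=q_1q_2\ldots q_k$ be a permutation of the ordinary set $\{1,\ldots,k\}$. For positive integers $n,m$, let $S_{n,m}(q)$ denote the number of permutations of the regular multiset $[n]_m$ that avoid $q$. Then there exists a constant $e_q$, depending only on the length $k$ of $q$, such that for all positive integers $n$ and $m$, \[ S_{n,m}(q)\le e_q^{\,n\cdot m}. \]
   Context: The regular multiset $[n]_m=\{1^m,2^m,\ldots,n^m\}$ is the multiset in which each of the elements $1,\ldots,n$ occurs exactly $m$ times. A permutation of $[n]_m$ is a word $p=p_1p_2\ldots p_{nm}$ over $\{1,\ldots,n\}$ in which each letter $i\in\{1,\ldots,n\}$ occurs exactly $m$ times. Such a word $p$ contains the pattern $q=q_1\ldots q_k$ if there exist indices $i_1<i_2<\cdots<i_k$ such that the subsequence $p_{i_1}p_{i_2}\ldots p_{i_k}$ is order-isomorphic to $q$, i.e. for all $a,b\in\{1,\ldots,k\}$ we have $p_{i_a}<p_{i_b}\iff q_a<q_b$ and $p_{i_a}=p_{i_b}\iff q_a=q_b$ (so, since $q$ has distinct entries, the chosen entries of $p$ are pairwise distinct). Otherwise $p$ avoids $q$. *)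

(* Defs.v *)
From mathcomp Require Import all_boot perm.

Set Implicit Arguments.
Unset Strict Implicit.
Unset Printing Implicit Defensive.

(* Letters and pattern entries are numbered from 0: 'I_n stands for {1, .., n}
   and 'S_k for the permutations of {1, .., k}. *)

Definition multiset_perm (n m : nat) (p : (n * m).-tuple 'I_n) : bool :=
  [forall i : 'I_n, count_mem i p == m].

Definition contains_pattern (N n k : nat) (p : N.-tuple 'I_n) (q : 'S_k) : bool :=
  [exists f : {ffun 'I_k -> 'I_N},
     [forall a : 'I_k, forall b : 'I_k, (a < b) ==> (f a < f b)] &&
     [forall a : 'I_k, forall b : 'I_k,
        ((tnth p (f a) < tnth p (f b)) == (q a < q b)) &&
        ((tnth p (f a) == tnth p (f b)) == (q a == q b))]].

Definition avoids_pattern (N n k : nat) (p : N.-tuple 'I_n) (q : 'S_k) : bool :=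
  ~~ contains_pattern p q.

Definition num_avoiders (n m k : nat) (q : 'S_k) : nat :=
  #|[set p : (n * m).-tuple 'I_n | multiset_perm p & avoids_pattern p q]|.

(* Main.v *)
(** A word of length [N = n * m] over [n <= N] letters is encoded by its graph,
    an [N x N] 0-1 matrix; a word avoiding [q] has a graph avoiding the
    permutation matrix of [q].  Cut such a matrix into square blocks and contract
    each nonempty block to a single 1: the result still avoids [q].

    Marcus and Tardos: only [O(N)] blocks are wide or tall, i.e. meet at least
    [k] columns or [k] rows, and each other block has fewer than [k ^ 2] ones.
    Blocks of side [4 (k + 1) ^ 2] then make the recursion for the maximal
    number of ones linear.

    Klazar: contracting blocks of side 4, a matrix is determined by its
    contraction [B] and a subset of the [16 #|B| = O(N)] cells above [B], so the
    number of avoiding matrices is at most exponential in [N]. *)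

Require Import Defs.
From mathcomp Require Import all_boot all_order perm all_algebra.
From mathcomp Require Import reals.
From mathcomp Require Import zify.

Set Implicit Arguments.
Unset Strict Implicit.
Unset Printing Implicit Defensive.

(** * Pattern containment in 0-1 matrices *)

Definition increasing k n (f : 'I_k -> 'I_n) : Prop :=
  forall a b : 'I_k, a < b -> f a < f b.

(** A 0-1 matrix is the set of its one-cells, row first; the pattern matrix has its ones at
    [(a, q a)]. *)
Definition mx_contains k n (q : 'S_k) (A : {set 'I_n * 'I_n}) : bool :=
  [exists f : {ffun 'I_k -> 'I_n}, exists g : {ffun 'I_k -> 'I_n},
     [forall a : 'I_k, forall b : 'I_k,
        (a < b) ==> ((f a < f b) && (g a < g b))] &&
     [forall a : 'I_k, (f a, g (q a)) \in A]].

Lemma mx_containsP k n (q : 'S_k) (A : {set 'I_n * 'I_n}) :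
  reflect (exists f g : 'I_k -> 'I_n,
             [/\ increasing f, increasing g & forall a, (f a, g (q a)) \in A])
          (mx_contains q A).
Proof.
apply: (iffP existsP) => [[f /existsP[g /andP[/forallP fgP /forallP AP]]]|].
  by exists f, g; split=> // a b lt_ab;
     case/andP: (implyP (forallP (fgP a) b) lt_ab).
case=> [f [g [fP gP AP]]]; exists [ffun a => f a].
apply/existsP; exists [ffun a => g a]; apply/andP; split.
  apply/forallP=> a; apply/forallP=> b; apply/implyP=> lt_ab.
  by rewrite !ffunE fP ?gP.
by apply/forallP=> a; rewrite !ffunE.
Qed.

(** Transposing the permutation matrix of [q] gives that of [q^-1]; this carries bounds on wide
    blocks over to tall ones. *)
Lemma mx_contains_tr k n (q : 'S_k) (A : {set 'I_n * 'I_n}) :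
  mx_contains (q^-1)%g [set (x.2, x.1) | x in A] -> mx_contains q A.
Proof.
case/mx_containsP=> [f [g [fP gP AP]]]; apply/mx_containsP.
exists g, f; split=> // a.
by case/imsetP: (AP (q a)) => -[i j] /= Aij []; rewrite permK => -> ->.
Qed.

Lemma card_le_fibers (T U : finType) (f : T -> U) (P : {set T}) b :
  (forall u, #|[set x in P | f x == u]| <= b) -> #|P| <= #|U| * b.
Proof.
move=> leb; rewrite -sum1_card (partition_big f xpredT) //= -sum_nat_const.
by apply: leq_sum => u _; rewrite sum1dep_card.
Qed.

Lemma increasing_in_set n k (X : {set 'I_n}) : k <= #|X| ->
  exists2 e : 'I_k -> 'I_n, increasing e & forall a, e a \in X.
Proof.
move=> leX; case: k leX => [|k] leX.
  by exists (fun a : 'I_0 => False_rect _ (notF (ltn_ord a))) => [[]|[]].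
have szX : size (enum X) = #|X| by rewrite cardE.
have x0 : 'I_n by case: (enum X) szX leX => [<-|].
have lt_trans : transitive (fun i j : 'I_n => i < j) by move=> y x z; apply: ltn_trans.
have sX : sorted (fun i j : 'I_n => i < j) (enum X).
  apply: sorted_filter => //.
  by have := iota_ltn_sorted 0 n; rewrite -val_enum_ord sorted_map enumT.
have lta (a : 'I_k.+1) : a < size (enum X).
  by rewrite szX (leq_trans _ leX).
exists (fun a => nth x0 (enum X) a) => [a b lt_ab|a].
  exact: (sorted_ltn_nth lt_trans x0 sX) (lta a) (lta b) lt_ab.
by rewrite -mem_enum mem_nth.
Qed.

(** * Square blocks and contraction *)

Section Blocks.

Variables d n : nat.

(** Number of blocks per side, for blocks of side [d.+1]; the successor accounts for an incomplete
    last block. *)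
Local Notation h := (n %/ d.+1).+1.

Definition quo (i : 'I_n) : 'I_h := inord (i %/ d.+1).
Definition rmd (i : 'I_n) : 'I_d.+1 := inord (i %% d.+1).
Definition quo2 (x : 'I_n * 'I_n) : 'I_h * 'I_h := (quo x.1, quo x.2).

Definition contract (A : {set 'I_n * 'I_n}) : {set 'I_h * 'I_h} := quo2 @: A.

Lemma val_quo i : quo i = i %/ d.+1 :> nat.
Proof. by rewrite inordK // ltnS leq_div2r // ltnW. Qed.

Lemma val_rmd i : rmd i = i %% d.+1 :> nat.
Proof. by rewrite inordK // ltn_pmod. Qed.

Lemma quo_rmd_inj i j : quo i = quo j -> rmd i = rmd j -> i = j.
Proof.
move=> /(congr1 val)/= eq1 /(congr1 val)/= eq2; apply: val_inj => /=.
by rewrite (divn_eq i d.+1) (divn_eq j d.+1) -!val_quo -!val_rmd eq1 eq2.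
Qed.

Lemma ltn_quo i j : quo i < quo j -> i < j.
Proof. by rewrite !val_quo; apply: contraTT; rewrite -!leqNgt => /leq_div2r->. Qed.

Lemma ltn_rmd i j : quo i = quo j -> rmd i < rmd j -> i < j.
Proof.
move=> /(congr1 val)/= eq1; rewrite (divn_eq i d.+1) (divn_eq j d.+1).
by rewrite -!val_quo -!val_rmd eq1 ltn_add2l.
Qed.

(** Choose a one of [A] in each block of the occurrence: strictly increasing block indices force
    strictly increasing coordinates. *)
Lemma contract_contains k (q : 'S_k) A :
  mx_contains q (contract A) -> mx_contains q A.
Proof.
case/mx_containsP=> [f [g [fP gP AP]]]; apply/mx_containsP.
have /fin_all_exists[x xP] a : exists x,
    [/\ x \in A, quo x.1 = f a & quo x.2 = g (q a)].
  by case/imsetP: (AP a) => x Ax [-> ->]; exists x.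
exists (fun a => (x a).1), (fun b => (x (q^-1 b)%g).2); split.
- by move=> a b lt_ab; apply: ltn_quo; case: (xP a) (xP b) => _ -> _ [_ -> _]; apply: fP.
- move=> a b lt_ab; apply: ltn_quo.
  case: (xP (q^-1 a)%g) (xP (q^-1 b)%g) => _ _ -> [_ _ ->].
  by rewrite !permKV; apply: gP.
- by move=> a; rewrite permK -surjective_pairing; case: (xP a).
Qed.

Lemma card_contract_preim (B : {set 'I_h * 'I_h}) :
  #|quo2 @^-1: B| <= #|B| * d.+1 ^ 2.
Proof.
rewrite -sum1_card (partition_big quo2 (mem B)) /=; last by move=> x; rewrite inE.
rewrite -sum_nat_const; apply: leq_sum => u _; rewrite sum1dep_card.
have -> : d.+1 ^ 2 = #|{: 'I_d.+1 * 'I_d.+1}| by rewrite card_prod card_ord.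
rewrite -(card_in_imset (f := fun x => (rmd x.1, rmd x.2))) ?max_card //.
move=> [i j] [i' j']; rewrite !inE /= => /andP[_ /eqP<-] /andP[_ /eqP[e1 e2]] [r1 r2].
by congr (_, _); apply: quo_rmd_inj.
Qed.

Definition block (A : {set 'I_n * 'I_n}) (B : 'I_h * 'I_h) :=
  [set x in A | quo2 x == B].
(** Columns are taken relative to the block, so that different blocks can be compared. *)
Definition block_cols A B : {set 'I_d.+1} := [set rmd x.2 | x in block A B].
Definition block_rows A B : {set 'I_d.+1} := [set rmd x.1 | x in block A B].

Lemma card_block A B : #|block A B| <= #|block_rows A B| * #|block_cols A B|.
Proof.
rewrite -cardsX -(card_in_imset (f := fun x => (rmd x.1, rmd x.2))).
  apply: subset_leq_card; apply/subsetP=> _ /imsetP[x xB ->].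
  by apply/setXP; split; apply: imset_f.
move=> [i j] [i' j']; rewrite !inE /= => /andP[_ /eqP<-] /andP[_ /eqP[e1 e2]] [r1 r2].
by congr (_, _); apply: quo_rmd_inj.
Qed.

(* Among the wide blocks of one block column, k blocks whose nonempty columns
   agree would contain every k x k permutation matrix. *)
Lemma card_wide k (q : 'S_k) A : ~~ mx_contains q A ->
  #|[set B | k <= #|block_cols A B|]| <= h * 2 ^ d.+1 * k.
Proof.
move=> avA.
have -> : h * 2 ^ d.+1 = #|{: 'I_h * {set 'I_d.+1}}|.
  by rewrite card_prod !card_ord -(cardsT {set _}) -powersetT card_powerset cardsT card_ord.
apply: (@card_le_fibers _ _ (fun B => (B.2, block_cols A B))) => -[J C].
rewrite leqNgt; apply: contra avA => /ltnW.
set F := [set _ in _ | _] => leF.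
have FP B : B \in F -> [/\ B.2 = J, block_cols A B = C & k <= #|C|].
  by rewrite !inE => /andP[+ /eqP[-> <-]]; split.
have : k <= #|[set B.1 | B in F]|.
  rewrite card_in_imset // => -[I1 J1] [I2 J2] /FP[/= -> _ _] /FP[/= -> _ _] -> //.
case/increasing_in_set=> r rP rF.
have rC a : block_cols A (r a, J) = C.
  by case/imsetP: (rF a) => -[I J'] /FP[/= -> <- _] ->.
have [c cP cC] : exists2 c : 'I_k -> 'I_d.+1, increasing c & forall a, c a \in C.
  case: (posnP k) => [k0|k_gt0].
    by exists (fun=> ord0) => a; have := ltn_ord a; rewrite {2}k0.
  apply: increasing_in_set.
  by case/imsetP: (rF (Ordinal k_gt0)) => B /FP[].
(* All blocks [(r a, J)] share the nonempty columns [C], so the [a]-th one can supply the column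
   [c (q a)] that the pattern asks for. *)
have /fin_all_exists[x xP] a : exists x,
    [/\ x \in A, quo x.1 = r a, quo x.2 = J & rmd x.2 = c (q a)].
  have := cC (q a); rewrite -(rC a) => /imsetP[x + ->].
  by rewrite inE => /andP[Ax /eqP[<- <-]]; exists x.
apply/mx_containsP; exists (fun a => (x a).1), (fun b => (x (q^-1 b)%g).2); split.
- move=> a b lt_ab; apply: ltn_quo.
  by case: (xP a) (xP b) => _ -> _ _ [_ -> _ _]; apply: rP.
- move=> a b lt_ab; case: (xP (q^-1 a)%g) (xP (q^-1 b)%g) => _ _ qa ra [_ _ qb rb].
  by apply: ltn_rmd; rewrite ?qa ?qb // ra rb !permKV; apply: cP.
- by move=> a; rewrite permK -surjective_pairing; case: (xP a).
Qed.

(** Tall blocks are the wide blocks of the transpose, which avoids [q^-1]. *)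
Lemma card_tall k (q : 'S_k) A : ~~ mx_contains q A ->
  #|[set B | k <= #|block_rows A B|]| <= h * 2 ^ d.+1 * k.
Proof.
move/(contra (@mx_contains_tr _ _ _ _))/card_wide; apply: leq_trans.
set A' := [set _ | _ in _].
have rowsE B : block_rows A B = block_cols A' (B.2, B.1).
  apply/setP=> c; apply/imsetP/imsetP => -[x].
    case: B => I J; rewrite inE => /andP[Ax /eqP[<- <-]] ->.
    by exists (x.2, x.1); rewrite // inE eqxx andbT; apply/imsetP; exists x.
  case: B => I J; rewrite inE => /andP[/imsetP[y Ay ->] /eqP[<- <-]] ->.
  by exists y; rewrite // inE Ay eqxx.
have swap_inj : injective (fun B : 'I_h * 'I_h => (B.2, B.1)).
  by move=> [I J] [I' J'] /= [-> ->].
rewrite -(card_imset _ swap_inj); apply: subset_leq_card.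
by apply/subsetP=> _ /imsetP[B + ->]; rewrite !inE rowsE.
Qed.

Lemma card_contract k (q : 'S_k) A : ~~ mx_contains q A ->
  #|A| <= k ^ 2 * #|contract A| + d.+1 ^ 2 * (2 * (h * 2 ^ d.+1 * k)).
Proof.
move=> avA; set W := [set B | k <= #|block_cols A B|].
set V := [set B | k <= #|block_rows A B|].
have -> : #|A| = \sum_(B in contract A) #|block A B|.
  rewrite -sum1_card (partition_big quo2 (mem (contract A))) /=.
    by apply: eq_bigr => B _; rewrite sum1dep_card; apply: eq_card => x; rewrite !inE.
  by move=> x Ax; apply: imset_f.
(* A wide or tall block is charged its full area; the sum of indicators charges it twice if it is
   both. *)
have leB B : #|block A B| <= k ^ 2 + d.+1 ^ 2 * ((B \in W) + (B \in V)).
  apply: leq_trans (card_block A B) _; rewrite !inE.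
  have lec : #|block_cols A B| <= d.+1 by rewrite -[leqRHS]card_ord max_card.
  have ler : #|block_rows A B| <= d.+1 by rewrite -[leqRHS]card_ord max_card.
  case: (leqP k #|block_cols A B|) => hc; last case: (leqP k #|block_rows A B|) => hr.
  - by apply: leq_trans (leq_mul ler lec) _; rewrite mulnn mulnDr muln1; lia.
  - by apply: leq_trans (leq_mul ler lec) _; rewrite mulnn muln1; lia.
  - by apply: leq_trans (leq_mul (ltnW hr) (ltnW hc)) _; rewrite mulnn leq_addr.
apply: (@leq_trans (\sum_(B in contract A)
                      (k ^ 2 + d.+1 ^ 2 * ((B \in W) + (B \in V))))).
  exact: leq_sum.
rewrite big_split /= sum_nat_const mulnC leq_add2l -big_distrr leq_mul2l /=.
rewrite big_split /= mul2n -addnn.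
have cardE' (X : {set 'I_h * 'I_h}) : \sum_(B in contract A) (B \in X) <= #|X|.
  rewrite -sum1_card big_mkcond [leqRHS]big_mkcond /=.
  by apply: leq_sum => B _; case: (B \in contract A); case: (B \in X).
by rewrite leq_add // (leq_trans (cardE' _)) ?(card_wide avA) ?(card_tall avA).
Qed.

End Blocks.

(** * Linear bound on the number of ones *)

Lemma card_avoiding_linear k : exists c, forall (q : 'S_k) n (A : {set 'I_n * 'I_n}),
  ~~ mx_contains q A -> #|A| <= c * n.
Proof.
(* With this side, [k ^ 2 * h <= n / 2], so the contraction contributes at most half of [c * n];
   [k.+1] keeps the side positive. *)
pose d := 4 * k.+1 ^ 2 - 1; have dE : d.+1 = 4 * k.+1 ^ 2 by rewrite /d; lia.
pose D := d.+1 ^ 2 * (2 * (2 ^ d.+1 * k)).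
(* The term [d.+1] settles [n < d.+1] through [n ^ 2 <= d.+1 * n]; [4 * D] absorbs the wide and tall
   blocks. *)
exists (d.+1 + 4 * D) => q n; elim/ltn_ind: n => n IHn A avA.
case: (ltnP n d.+1) => [lt_nd | le_dn].
  apply: leq_trans (max_card _) _; rewrite card_prod card_ord leq_mul2r.
  by rewrite (leq_trans (ltnW lt_nd)) ?leq_addr ?orbT.
have le_h : (n %/ d.+1).+1 * d.+1 <= 2 * n.
  by have := leq_trunc_div n d.+1; lia.
have lt_h : (n %/ d.+1).+1 < n by nia.
have := card_contract d avA.
have := IHn _ lt_h (contract d A) (contra (@contract_contains _ _ _ _ _) avA).
move: #|contract d A| le_h => b.
move: (n %/ d.+1).+1 {lt_h} => h le_h leB leA; apply: leq_trans leA _.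
have -> : d.+1 ^ 2 * (2 * (h * 2 ^ d.+1 * k)) = D * h by rewrite /D; nia.
move: leB; set c := d.+1 + 4 * D => leB.
have leD : D * 4 <= c by rewrite /c mulnC leq_addl.
have leK : k ^ 2 <= k.+1 ^ 2 by rewrite leq_sqr.
have le_hK : h * k.+1 ^ 2 * 2 <= n by move: le_h; rewrite dE; lia.
have le_hn : h * 2 <= n.
  by apply: leq_trans le_hK; rewrite leq_mul2r leq_pmulr ?expn_gt0.
have : k ^ 2 * b * 2 <= c * n.
  apply: leq_trans (leq_mul (leq_mul leK leB) (leqnn 2)) _.
  have -> : k.+1 ^ 2 * (c * h) * 2 = c * (h * k.+1 ^ 2 * 2) by lia.
  by rewrite leq_mul2l le_hK orbT.
have : D * 4 * (h * 2) <= c * n by apply: leq_mul.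
lia.
Qed.

(** * Counting avoiding matrices *)

Definition avoiding k n (q : 'S_k) : {set {set 'I_n * 'I_n}} :=
  [set A | ~~ mx_contains q A].

Lemma card_avoiding_exp k : exists a, forall (q : 'S_k) n,
  #|avoiding n q| <= 2 ^ (a * n).
Proof.
have [c cP] := card_avoiding_linear k.
(* Writing [a] for this constant, the recursion gives the exponent
   [(a + 16 * c) * h <= a * (2 * h) <= a * n]; the summand 4 settles [n < 4], where
   [n ^ 2 <= 4 * n]. *)
exists (16 * c + 4) => q n; elim/ltn_ind: n => n IHn.
case: (ltnP n 4) => [lt_n4 | le_4n].
  apply: leq_trans (max_card _) _.
  rewrite -(cardsT {set _}) -powersetT card_powerset cardsT card_prod card_ord.
  by rewrite leq_exp2l //; nia.
have lt_h : (n %/ 4).+1 < n by lia.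
set h := (n %/ 4).+1 in lt_h *.
have le_h : h * 2 <= n by rewrite /h; lia.
have fiber (B : {set 'I_h * 'I_h}) : B \in avoiding h q ->
    #|[set A in avoiding n q | contract 3 A == B]| <= 2 ^ (16 * c * h).
  rewrite inE => /cP leB.
  apply: (@leq_trans #|powerset (@quo2 3 n @^-1: B)|).
    apply: subset_leq_card; apply/subsetP=> A; rewrite !inE => /andP[_ /eqP<-].
    by apply/subsetP=> x Ax; rewrite inE imset_f.
  rewrite card_powerset leq_exp2l //.
  apply: leq_trans (card_contract_preim B) _.
  by rewrite -mulnA mulnC leq_mul2l leB orbT.
have -> : #|avoiding n q| =
    \sum_(B in avoiding h q) #|[set A in avoiding n q | contract 3 A == B]|.
  rewrite -sum1_card (partition_big (@contract 3 n) (mem (avoiding h q))) /=.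
    by apply: eq_bigr => B _; rewrite sum1dep_card.
  by move=> A; rewrite !inE; apply/contra/contract_contains.
apply: (@leq_trans (\sum_(B in avoiding h q) 2 ^ (16 * c * h))).
  exact: leq_sum.
rewrite sum_nat_const.
apply: (@leq_trans (2 ^ ((16 * c + 4) * h) * 2 ^ (16 * c * h))).
  by rewrite leq_mul2r IHn ?orbT.
rewrite -expnD leq_exp2l //.
apply: (@leq_trans ((16 * c + 4) * (h * 2))); last by rewrite leq_mul2l le_h orbT.
lia.
Qed.

(** * From words to matrices *)

Definition word_graph N n (le_nN : n <= N) (p : N.-tuple 'I_n) :
    {set 'I_N * 'I_N} :=
  [set x | x.2 == widen_ord le_nN (tnth p x.1)].

Lemma word_graph_inj N n (le_nN : n <= N) : injective (@word_graph N n le_nN).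
Proof.
move=> p p' /setP eqpp; apply: eq_from_tnth => i; apply: val_inj.
by have := eqpp (i, widen_ord le_nN (tnth p i)); rewrite !inE eqxx => /esym/eqP[].
Qed.

Lemma increasing_ltn k n (f : 'I_k -> 'I_n) : increasing f ->
  forall a b, (f a < f b) = (a < b).
Proof.
move=> fP a b; case: (ltngtP a b) => [/fP //|/fP/ltnW|/val_inj->]; last exact: ltnn.
by rewrite leqNgt => /negPf.
Qed.

(** Rows are positions and columns are letters: the entry at position [f a] is [g (q a)], and an
    increasing [g] preserves and reflects order. *)
Lemma word_graph_contains N n k (le_nN : n <= N) (p : N.-tuple 'I_n) (q : 'S_k) :
  mx_contains q (word_graph le_nN p) -> contains_pattern p q.
Proof.
case/mx_containsP=> [f [g [fP gP AP]]].
have pE a : tnth p (f a) = g (q a) :> nat.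
  by have := AP a; rewrite inE /= => /eqP->.
apply/existsP; exists [ffun a => f a]; apply/andP; split.
  by apply/forallP=> a; apply/forallP=> b; apply/implyP; rewrite !ffunE => /fP.
apply/forallP=> a; apply/forallP=> b; rewrite !ffunE -!(inj_eq val_inj) /= !pE.
by rewrite !eqn_leq !(leqNgt (g _)) !(leqNgt (q _)) !(increasing_ltn gP) !eqxx.
Qed.

(** Since [m] is positive, the [n] letters fit into [n * m] columns, and taking graphs is
    injective. *)
Lemma num_avoiders_le n m k (q : 'S_k) : 0 < m ->
  num_avoiders n m q <= #|avoiding (n * m) q|.
Proof.
move=> m_gt0; have le_nN : n <= n * m by rewrite leq_pmulr.
rewrite /num_avoiders -(card_imset _ (@word_graph_inj _ _ le_nN)).
apply: subset_leq_card; apply/subsetP=> _ /imsetP[p + ->].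
by rewrite !inE => /andP[_]; apply/contra/word_graph_contains.
Qed.

Theorem theorem2 (R : realType) (k : nat) (hk : (0 < k)%N) :
  exists e : R, forall (q : 'S_k) (n m : nat),
    (0 < n)%N -> (0 < m)%N ->
    ((num_avoiders n m q)%:R <= e ^+ (n * m)%N)%R.
Proof.
have [a aP] := card_avoiding_exp k.
exists (2 ^ a)%:R%R => q n m _ m_gt0.
rewrite -GRing.natrX Num.Theory.ler_nat -expnM.
exact: leq_trans (num_avoiders_le n q m_gt0) (aP q _).
Qed.
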